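(* Let $G$ be a finite group, let $V$ be a rational FPF representation of $G$ of dimension $n=\dim_{\mathbb{Q}}V$, let $L\subset V$ be a $G$-invariant full-rank lattice, and consider the induced $G$-action on $V_{\mathbb{C}}/L$. Let $F=\{x\in V_{\mathbb{C}}/L : G_x\neq\{e\}\}$ be the set of non-free points, where $G_x$ is the stabilizer of $x$. Then \[|F| = -\sum_{d\mid |G|} \mu(d)\cdot c_d(G)\cdot\Phi_{d}(1)^{\frac{n}{\varphi(d)}},\] where $c_d(G)$ is the number of cyclic subgroups of $G$ of order $d$.
   Context: A rational FPF (fixed-point-free) representation of a finite group $G$ is a nonzero finite-dimensional $\mathbb{Q}$-vector space $V$ with a linear $G$-action such that $\det(g-\mathrm{id}\mid V)\neq 0$ for every non-identity $g\in G$. A $G$-invariant full-rank lattice $L\subset V$ is a $G$-stable free $\mathbb{Z}$-submodule spanned by a $\mathbb{Q}$-basis of $V$. Put $V_{\mathbb{C}}=V\otimes_{\mathbb{Q}}\mathbb{C}$; the action of $G$ extends $\mathbb{C}$-linearly to $V_{\mathbb{C}}$ and induces an action on the torus $V_{\mathbb{C}}/L\cong(\mathbb{C}/\mathbb{Z})^n$ by $g\cdot[x]=[gx]$. Here $\mu$ is the classical Möbius function, $\varphi$ is Euler's totient function, and $\Phi_d$ is the $d$-th cyclotomic polynomial (so $\Phi_1(1)=0$). *)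

(* Defs.v *)
From HB Require Import structures.
From mathcomp Require Import all_boot all_order all_algebra all_fingroup.
From mathcomp Require Import all_solvable all_field mxrepresentation.
From mathcomp Require Import generic_quotient ring_quotient.
From mathcomp Require Import finmap.
From mathcomp Require Import boolp classical_sets cardinality reals exp.
From mathcomp Require Import complex.
Set Implicit Arguments.
Unset Strict Implicit.
Unset Printing Implicit Defensive.
Import GRing.Theory.
Local Open Scope ring_scope.

(* The value at d = 0 is irrelevant: only d > 0 is the classical function. *)
Definition moebius (d : nat) : int :=
  if all (fun p => logn p d == 1%N) (primes d) then (-1) ^+ size (primes d)
  else 0.

Definition ncyclic (gT : finGroupType) (G : {group gT}) (d : nat) : nat :=
  #|[set H : {group gT} | [&& H \subset G, cyclic H & #|H| == d]]%SET|.

(* V is rat^n as column vectors, g acting by v |-> rG g *m v: since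
   rG (g * h) = rG g *m rG h on G, this is a left action. *)
Definition fpf_repr (gT : finGroupType) (G : {group gT}) (n : nat)
    (rG : mx_representation rat G n) : Prop :=
  (0 < n)%N /\
  forall g, g \in G -> g != 1%g -> \det (rG g - 1%:M) != 0.

(* The columns of B are a rat-basis of V, and the lattice is their int-span. *)
Record lattice (n : nat) := Lattice {
  lattice_set : set 'cV[rat]_n;
  latticeP : exists2 B : 'M[rat]_n, B \in unitmx &
    lattice_set
    = [set B *m map_mx intr z | z in [set: 'cV[int]_n]]%classic }.

Definition mx_stable (n : nat) (L : lattice n) (A : 'M[rat]_n) : Prop :=
  forall v, lattice_set L v -> lattice_set L (A *m v).

Definition lattice_invariant (gT : finGroupType) (G : {group gT}) (n : nat)
    (rG : mx_representation rat G n) (L : lattice n) : Prop :=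
  forall g, g \in G -> mx_stable L (rG g).

Section Torus.
Variables (R : realType) (n : nat) (L : lattice n).
Local Notation VC := 'cV[R[i]]_n.

(* The image of L in VC = V (x)_Q C. *)
Definition latticeC : {pred VC} :=
  fun x => `[< exists2 v, lattice_set L v & x = map_mx ratr v >].

Lemma latticeC_zmod_closed : zmod_closed latticeC.
Proof.
have [B _ LE] := latticeP L.
split=> [|x y].
  apply/asboolP; exists 0; last by rewrite map_mx0.
  by rewrite LE; exists 0 => //; rewrite map_mx0 mulmx0.
move=> /asboolP[v Lv ->] /asboolP[w Lw ->]; apply/asboolP.
exists (v - w); last by rewrite map_mxB.
move: Lv Lw; rewrite LE => -[a _ <-] [b _ <-].
by exists (a - b) => //; rewrite map_mxB mulmxBr.
Qed.

HB.instance Definition _ :=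
  GRing.isZmodClosed.Build VC latticeC latticeC_zmod_closed.

Definition torus := Quotient.quot latticeC.
HB.instance Definition _ := GRing.Zmodule.on torus.
HB.instance Definition _ := Quotient.on torus.

(* [x] |-> [A x], through a chosen representative of [x]. It does not depend
   on that choice when A stabilizes L: see torus_mulE. *)
Definition torus_mul (A : 'M[rat]_n) : torus -> torus :=
  lift_op1 torus (mulmx (map_mx ratr A)).

Lemma torus_mulE (A : 'M[rat]_n) (x : VC) : mx_stable L A ->
  torus_mul A (\pi_torus x)%qT = (\pi_torus (map_mx ratr A *m x))%qT.
Proof.
move=> LA; rewrite /torus_mul; unlock; apply/eqP.
rewrite -Quotient.idealrBE -mulmxBr.
have : repr (\pi_torus x)%qT - x \in latticeC.
  by rewrite Quotient.idealrBE reprK.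
by move=> /asboolP[v Lv ->]; apply/asboolP; exists (A *m v);
  [exact: LA | rewrite map_mxM].
Qed.

End Torus.

Section NonFree.
Variables (R : realType) (gT : finGroupType) (G : {group gT}) (n : nat).
Variables (rG : mx_representation rat G n) (L : lattice n).

Definition torus_stab (x : torus R L) : {set gT} :=
  [set g in G | torus_mul (rG g) x == x]%SET.

Definition nonfree : set (torus R L) :=
  [set x | torus_stab x <> [set 1%g]%SET]%classic.

End NonFree.

Arguments nonfree R {gT G n} rG L.

(* Main.v *)
(* Let H be a nontrivial subgroup of G. On an FPF representation the sum of the
   elements of H is zero, because its image is fixed by H. Sorting the elements
   of a cyclic subgroup C by the subgroup they generate, Moebius inversion shows
   that the generators of C sum to mu(|C|) Id. Sorting the elements of H in the
   same way gives sum_(C <= H cyclic) mu(|C|) = 0. With H the stabilizer of a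
   non-free point x, this reads
     - sum_(1 <> C <= G_x cyclic) mu(|C|) = 1,
   and summing over x in F yields |F| = - sum_(C <> 1) mu(|C|) |Fix C|.
   If C is generated by g of order d > 1, then |Fix C| = |det (g - 1)|, by the
   Smith normal form of g - 1 on L. All eigenvalues of g are primitive d-th
   roots of unity, so the characteristic polynomial of g is a power of the
   irreducible Phi_d, and |Fix C| = Phi_d(1)^(n / phi(d)). The term d = 1 of
   the formula vanishes since Phi_1(1) = 0. *)

Require Import Defs.
From HB Require Import structures.
From mathcomp Require Import all_boot all_order all_algebra all_fingroup.
From mathcomp Require Import all_solvable all_field mxrepresentation.
From mathcomp Require Import finmap.
From mathcomp Require Import boolp classical_sets cardinality reals exp.
From mathcomp Require Import complex.
Set Implicit Arguments.
Unset Strict Implicit.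
Unset Printing Implicit Defensive.
Import GRing.Theory Num.Theory.
Local Open Scope ring_scope.

(** * Divisor sums of the Möbius function *)

Lemma moebius_prime_mul (p e : nat) :
  prime p -> (0 < e)%N -> ~~ (p %| e)%N -> moebius (p * e) = - moebius e.
Proof.
move=> pp e0 npe; have p0 := prime_gt0 pp.
have pE : perm_eq (primes (p * e)) (p :: primes e).
  apply: uniq_perm; rewrite /= ?primes_uniq ?mem_primes ?(negPf npe) ?andbF //.
  by move=> q; rewrite primesM // (primes_prime pp) !inE.
rewrite /moebius (perm_all _ pE) (perm_size pE) /=.
rewrite lognM // logn_prime // eqxx lognE (negPf npe) !andbF /=.
have -> : all (fun q => logn q (p * e) == 1%N) (primes e)
          = all (fun q => logn q e == 1%N) (primes e).
  apply: eq_in_all => q; rewrite mem_primes => /and3P[_ _ qe].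
  rewrite lognM // logn_prime //.
  by case: (q =P p) qe => // ->; rewrite (negPf npe).
by case: ifP; rewrite ?oppr0 // exprS mulN1r.
Qed.

Lemma moebius_prime_mul_dvd (p e : nat) :
  prime p -> (0 < e)%N -> (p %| e)%N -> moebius (p * e) = 0.
Proof.
move=> pp e0 pe; rewrite /moebius; case: allP => // /(_ p).
rewrite mem_primes pp muln_gt0 prime_gt0 // e0 dvdn_mulr // => /(_ isT).
have : (0 < logn p e)%N by rewrite logn_gt0 mem_primes pp e0.
by rewrite lognM ?(prime_gt0 pp) // (logn_prime p pp) eqxx; case: (logn p e).
Qed.

(** Write [m = k * p] with [p] prime. The divisors of [m] that are multiples of [p] are the [p * e]
    with [e] dividing [k]. Their terms vanish if [p] divides [e]; the others cancel the terms of the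
    divisors of [m] prime to [p]. *)
Lemma sum_moebius (m : nat) :
  (0 < m)%N -> \sum_(d <- divisors m) moebius d = (m == 1%N)%:R.
Proof.
move=> m0; have [->|m1] := eqVneq m 1%N; first by rewrite big_seq1.
have pp : prime (pdiv m) by apply: pdiv_prime; case: m m0 m1 => [|[]].
have /dvdnP[k mE] := pdiv_dvd m; move: (pdiv m) pp mE => p pp mE.
have p0 := prime_gt0 pp.
have k0 : (0 < k)%N by move: m0; rewrite mE muln_gt0 => /andP[].
rewrite (bigID (dvdn p)) /= -[X in X + _]big_filter.
rewrite (perm_big [seq (p * e)%N | e <- divisors k]) /=; last first.
  apply: uniq_perm; first by rewrite filter_uniq ?divisors_uniq.
    by rewrite map_inj_uniq ?divisors_uniq // => x y /eqP; rewrite eqn_pmul2l // => /eqP.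
  move=> d; rewrite mem_filter -dvdn_divisors //.
  apply/andP/mapP => [[/dvdnP[e ->]]|[e]].
    rewrite mE dvdn_pmul2r // => ek; exists e; last exact: mulnC.
    by rewrite -dvdn_divisors.
  by rewrite -dvdn_divisors // => ek ->; rewrite dvdn_mulr // mE mulnC dvdn_pmul2r.
rewrite big_map (bigID (dvdn p)) /= big_seq_cond big1 ?add0r; last first.
  move=> e /andP[]; rewrite -dvdn_divisors // => /(dvdn_gt0 k0) e0 pe.
  exact: moebius_prime_mul_dvd.
rewrite big_seq_cond (eq_bigr (fun e => - moebius e)); last first.
  move=> e /andP[]; rewrite -dvdn_divisors // => /(dvdn_gt0 k0) e0 pe.
  exact: moebius_prime_mul.
rewrite -big_seq_cond -big_filter -[X in _ + X]big_filter sumrN addrC.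
apply/eqP; rewrite subr_eq0; apply/eqP/perm_big/uniq_perm;
  rewrite ?filter_uniq ?divisors_uniq // => e.
rewrite !mem_filter -!dvdn_divisors // mE.
have [//|npe /=] := boolP (p %| e)%N.
by rewrite Gauss_dvdl // coprime_sym prime_coprime.
Qed.

(** * Sums over cyclic subgroups, sorted by order *)

Lemma sum_cyclic_subgroups (gT : finGroupType) (G : {group gT})
    (V : nmodType) (F : nat -> V) :
  \sum_(C : {group gT} | (C \subset G) && cyclic C) F #|C| =
  \sum_(d <- divisors #|G|) F d *+ ncyclic G d.
Proof.
under [RHS]eq_bigr => d _.
  rewrite /ncyclic -sumr_const (eq_bigl (fun C : {group gT} =>
    ((C \subset G) && cyclic C) && (d == #|C|))); first over.
  by move=> C; rewrite inE andbA [d == _]eq_sym.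
rewrite (exchange_big_dep (fun C : {group gT} => (C \subset G) && cyclic C)) /=.
  apply: eq_bigr => C /andP[CG cC]; rewrite CG cC /= -big_filter.
  rewrite (@perm_big _ _ _ _ _ [:: #|C|]) ?big_seq1 //.
  apply: uniq_perm; rewrite ?filter_uniq ?divisors_uniq // => d.
  rewrite mem_filter inE; case: eqP => //= ->.
  by rewrite -dvdn_divisors // cardSg.
by move=> d C _ /andP[].
Qed.

(** A cyclic group has exactly one subgroup of each order dividing its own, so every multiplicity
    [ncyclic C d] is 1. *)
Lemma sum_subgroups_of_cyclic (gT : finGroupType) (C : {group gT})
    (V : nmodType) (F : nat -> V) : cyclic C ->
  \sum_(D : {group gT} | (D \subset C) && cyclic D) F #|D| =
  \sum_(d <- divisors #|C|) F d.
Proof.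
move=> /[dup] cC /cyclicP[a CE]; rewrite sum_cyclic_subgroups.
apply: eq_big_seq => d; rewrite -dvdn_divisors // => dC.
rewrite /ncyclic (_ : [set _ | _]%SET = [set <[a ^+ (#[a] %/ d)]>%G])%g ?cards1 //.
rewrite -cycle_sub_group; last by rewrite orderE -CE.
rewrite -CE; apply/finset.setP => D; rewrite !inE.
by case: (boolP (D \subset C)) => //= DC; rewrite (cyclicS DC).
Qed.

(** * Sums of group elements in an FPF representation *)

Section Fpf.
Variables (gT : finGroupType) (G : {group gT}) (n : nat).
Variables (rG : mx_representation rat G n).
Hypothesis fpf : fpf_repr rG.

(* The image of the sum over H is fixed by H. *)
Lemma fpf_sum_group (H : {group gT}) : H \subset G ->
  \sum_(h in H) rG h = (#|H| == 1%N)%:R%:M.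
Proof.
move=> sHG; have [/card1_trivg H1|] := eqVneq #|H| 1%N.
  by rewrite H1 big_set1 repr_mx1.
rewrite -trivg_card1 => /trivgPn[h hH h1].
have [_ /(_ h (fintype.subsetP sHG h hH) h1)] := fpf; rewrite -unitfE -unitmxE => uh.
have hE : \sum_(k in H) rG h *m rG k = \sum_(k in H) rG k.
  rewrite [RHS](reindex_inj (mulgI h)) /=.
  apply: eq_big => [k|k kH]; first by rewrite groupMl.
  by rewrite repr_mxM // (fintype.subsetP sHG).
rewrite -[LHS](mulKmx uh) mulmxBl mul1mx mulmx_sumr hE subrr mulmx0.
by rewrite mulr0n raddf0.
Qed.

Lemma sum_by_generated (H : {group gT}) :
  \sum_(h in H) rG h =
  \sum_(C : {group gT} | (C \subset H) && cyclic C)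
    \sum_(h : gT | <[h]>%G == C) rG h.
Proof.
rewrite (partition_big (fun h => <[h]>%G)
  (fun C : {group gT} => (C \subset H) && cyclic C)) /=; last first.
  by move=> h hH; rewrite cycle_subG hH cycle_cyclic.
apply: eq_bigr => C /andP[CH _]; apply: eq_bigl => h.
(* The inner sums may range over all of [gT]: a generator of [C] lies in [C], hence in [H]. *)
apply: andb_idl => /eqP hC; apply: (fintype.subsetP CH); rewrite -hC; exact: cycle_id.
Qed.

(* Matrix form of: the primitive d-th roots of unity sum to mu(d). *)
Lemma fpf_sum_generators (C : {group gT}) : C \subset G -> cyclic C ->
  \sum_(h : gT | <[h]>%G == C) rG h = ((moebius #|C|)%:~R)%:M.
Proof.
have [m] := ubnP #|C|; elim: m C => // m IH C; rewrite ltnS => Cm CG cC.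
(* Both the sum of [rG] over [C] and the Möbius sum over subgroups of [C] equal 1 or 0 according to
   whether [C] is trivial. Equating them and cancelling the proper subgroups by induction leaves the
   term of [C]. *)
have := sum_by_generated C; rewrite fpf_sum_group //.
have := sum_moebius (cardG_gt0 C); rewrite -sum_subgroups_of_cyclic //.
move/(congr1 (intr : int -> rat)); rewrite rmorph_sum /= rmorph_nat => <-.
rewrite raddf_sum /=.
rewrite (bigD1 C) ?subxx ?cC //= [RHS](bigD1 C) ?subxx ?cC //=.
rewrite [X in _ = _ + X](eq_bigr (fun D : {group gT} => (moebius #|D|)%:~R%:M)).
  by move/addIr.
move=> D /andP[/andP[DC cD] DnC]; apply: IH => //;
  last exact: fintype.subset_trans DC CG.
apply: leq_trans Cm; apply: proper_card.
by rewrite finset.properEneq DC andbT; move: DnC; rewrite -val_eqE.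
Qed.

Lemma fpf_sum_moebius (H : {group gT}) : H \subset G ->
  \sum_(C : {group gT} | (C \subset H) && cyclic C) moebius #|C|
  = (#|H| == 1%N)%:R.
Proof.
move=> HG; have := sum_by_generated H; rewrite fpf_sum_group //.
rewrite (eq_bigr (fun D : {group gT} => (moebius #|D|)%:~R%:M)); last first.
  by move=> C /andP[CH cC]; apply: fpf_sum_generators => //; apply: fintype.subset_trans HG.
(* Both sides are scalar matrices; since [n] is positive, there is a diagonal entry at which to
   compare them. *)
rewrite -raddf_sum -rmorph_sum /=; case: fpf => n0 _.
move/matrixP => /(_ (Ordinal n0) (Ordinal n0)); rewrite !mxE eqxx !mulr1n.
by rewrite -(rmorph_nat intr) => /intr_inj.
Qed.

End Fpf.

(** * Cyclotomic polynomials: value at 1 and powers over the rationals *)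

Lemma Cyclotomic1E : 'Phi_1 = 'X - 1.
Proof. by rewrite -(prod_Cyclotomic (isT : 0 < 1)%N) big_seq1. Qed.

(** Dividing [X^d - 1] by [X - 1] and evaluating at 1 shows that the product of the [Phi_e(1)], for
    [e] dividing [d] and different from 1, is [d]. By induction all factors but [Phi_d(1)] are
    positive, so it is positive too. *)
Lemma Cyclotomic_at1_gt0 (d : nat) : (1 < d)%N -> 0 < ('Phi_d).[1].
Proof.
have [m] := ubnP d; elim: m d => // m IH d; rewrite ltnS => dm d1.
have d0 := ltnW d1.
have : 'Phi_1 * \prod_(e <- divisors d | e != 1%N) 'Phi_e
       = ('X - 1) * \sum_(i < d) 'X^i.
  by rewrite -subrX1 -prod_Cyclotomic // [RHS](bigD1_seq 1%N) ?divisors_uniq ?divisor1.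
rewrite -Cyclotomic1E => /(mulfI (monic_neq0 (Cyclotomic_monic 1))).
rewrite -big_filter (bigD1_seq d) ?filter_uniq ?divisors_uniq //=; last first.
  by rewrite mem_filter -dvdn_divisors // dvdnn gtn_eqF.
rewrite big_filter_cond.
move=> /(congr1 (fun p => p.[1])) /=; rewrite hornerM horner_sum horner_prod.
rewrite [RHS](eq_bigr (fun=> 1)) => [|i _]; last by rewrite hornerXn expr1n.
rewrite sumr_const card_ord.
set q := (X in _ * X = _) => E.
have q0 : 0 < q.
  rewrite /q big_seq_cond; apply: prodr_gt0 => e.
  rewrite -dvdn_divisors // => /and3P[ed e1 end_].
  have e0 := dvdn_gt0 d0 ed; have eld := dvdn_leq d0 ed.
  apply: IH; last by case: e e1 e0 {ed end_ eld} => [|[]].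
  by apply: leq_trans dm; rewrite ltn_neqAle end_ eld.
by rewrite -(pmulr_lgt0 _ q0) E ltr0n.
Qed.

Lemma pZtoQtoC (p : {poly int}) :
  map_poly (ratr : rat -> algC) (map_poly intr p) = map_poly intr p.
Proof. by rewrite -map_poly_comp; apply: eq_map_poly => z /=; rewrite ratr_int. Qed.

(** Any complex root of [p] has minimal polynomial [Phi_d] over the rationals; split off this factor
    and induct on the degree. *)
Lemma rat_poly_all_roots_primitive (d : nat) (p : {poly rat}) :
    (forall z : algC, root (map_poly ratr p) z -> d.-primitive_root z) ->
  p \is monic -> exists k, p = map_poly intr 'Phi_d ^+ k.
Proof.
have [m] := ubnP (size p); elim: m p => // m IH p; rewrite ltnS => pm rp monp.
have [p1|p1] := eqVneq (size p) 1%N.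
  exists 0%N; rewrite expr0; have [c c0 pE] := size_poly1P _ (introT eqP p1).
  by move: monp; rewrite pE monicE lead_coefC => /eqP ->.
have [z rz] : exists z : algC, root (map_poly ratr p) z.
  by apply/closed_rootP; rewrite size_map_poly.
have dz := rp _ rz; have [q [qE monq] rq] := minCpolyP z.
have {}qE : q = map_poly intr 'Phi_d.
  apply: (map_poly_inj (ratr : {rmorphism rat -> algC})).
  by rewrite -qE pZtoQtoC (minCpoly_cyclotomic dz) (Cintr_Cyclotomic dz).
have /dvdpP[r pE] : (q %| p)%R by rewrite -rq.
have monr : r \is monic by move: monp; rewrite pE monicMr.
have [||//|k rE] := IH r.
- apply: leq_trans pm; rewrite pE size_Mmonic ?monic_neq0 //.
  have := size_minCpoly z; rewrite (minCpoly_cyclotomic dz) -(Cintr_Cyclotomic dz).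
  rewrite -pZtoQtoC size_map_poly -qE; case: (size q) => [|[|s]] // _.
  by rewrite !addnS /= ltnS leq_addr.
- by move=> y ry; apply: rp; rewrite pE rmorphM rootM ry.
by exists k.+1; rewrite exprSr pE rE qE.
Qed.

(** * Characteristic polynomial and determinant of a group element *)

Section FpfDet.
Variables (gT : finGroupType) (G : {group gT}) (n : nat).
Variables (rG : mx_representation rat G n).
Hypothesis fpf : fpf_repr rG.

(** Let [v] be an eigenvector of [g] for [z]. If [z^m = 1], then [g^m - 1] kills [v], so it is
    singular and [g^m = 1] by the FPF condition. Hence [z] has exactly the order of [g]. *)
Lemma fpf_char_poly (g : gT) : g \in G ->
  exists k, char_poly (rG g) = map_poly intr 'Phi_#[g]%g ^+ k.
Proof.
move=> gG; apply: rat_poly_all_roots_primitive (char_poly_monic _) => z.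
rewrite map_char_poly -eigenvalue_root_char => /eigenvalueP[v vE v0].
have vX m : v *m map_mx ratr (rG (g ^+ m)%g) = z ^+ m *: v.
  elim: m => [|m IH]; first by rewrite repr_mx1 map_mx1 mulmx1 scale1r.
  rewrite expgSr repr_mxM ?groupX // map_mxM mulmxA IH -scalemxAl vE.
  by rewrite scalerA -exprSr.
have zX m : (z ^+ m == 1) = (#[g]%g %| m)%N.
  rewrite order_dvdn; apply/eqP/eqP => [zm|gm].
    apply/eqP; apply: contraNT v0 => gm.
    have [_ /(_ _ (groupX m gG) gm)] := fpf; rewrite -unitfE -unitmxE => u.
    have u' : map_mx (ratr : rat -> algC) (rG (g ^+ m)%g - 1%:M) \in unitmx.
      by rewrite map_unitmx.
    by rewrite -(mulmxK u' v) map_mxB map_mx1 mulmxBr mulmx1 vX zm scale1r subrr mul0mx.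
  have := vX m; rewrite gm repr_mx1 map_mx1 mulmx1 => /eqP.
  rewrite -subr_eq0 -{1}[v]scale1r -scalerBl scaler_eq0 (negPf v0) orbF.
  by rewrite subr_eq0 => /eqP.
apply/andP; split; first exact: order_gt0.
apply/forallP => i; rewrite unity_rootE zX; apply/eqP.
apply/idP/eqP => [dv|-> //]; apply/eqP; by rewrite eqn_leq ltn_ord dvdn_leq.
Qed.

(** Comparing degrees in [fpf_char_poly] gives [n], and evaluating at 1 gives [det (1 - g)]. The
    absolute value absorbs the sign [(-1)^n]. *)
Lemma fpf_norm_det (g : gT) : g \in G -> g != 1%g ->
  exists2 k, n = (k * totient #[g]%g)%N &
  `|\det (rG g - 1%:M)| = (('Phi_#[g]%g).[1])%:~R ^+ k :> rat.
Proof.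
move=> gG g1; have [k kE] := fpf_char_poly gG; exists k.
  have := congr1 (fun p : {poly rat} => (size p).-1) kE.
  rewrite size_char_poly size_exp size_map_inj_poly ?size_Cyclotomic //= 1?mulnC //.
  exact: intr_inj.
have -> : rG g - 1%:M = -1 *: (1%:M - rG g) by rewrite scaleN1r opprB.
have -> : 1%:M - rG g = map_mx (horner_eval 1) (char_poly_mx (rG g)).
  apply/matrixP => i j; rewrite !mxE /horner_eval hornerD hornerN hornerC.
  by rewrite hornerMn hornerX.
rewrite detZ normrM normrX normrN1 expr1n mul1r.
rewrite det_map_mx -/(char_poly _) kE /= /horner_eval horner_exp.
rewrite -[X in _.[X]](rmorph1 intr) horner_map normrX ger0_norm //.
by rewrite ler0z Order.POrderTheory.ltW // Cyclotomic_at1_gt0 // order_gt1.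
Qed.

End FpfDet.

(** * Fixed points of a lattice endomorphism on the torus *)

Section TorusFixedPoints.
Variables (R : realType) (n : nat) (L : lattice n).
Local Notation ratC := (ratr : rat -> R[i]).

Definition lattice_basis (B : 'M[rat]_n) : Prop :=
  B \in unitmx /\
  lattice_set L = [set B *m map_mx intr z | z in [set: 'cV[int]_n]]%classic.

Lemma lattice_basis_mulr (B : 'M[rat]_n) (P : 'M[int]_n) :
  lattice_basis B -> P \in unitmx -> lattice_basis (B *m map_mx intr P).
Proof.
move=> [uB LE] uP; split.
  rewrite unitmx_mul uB unitmxE det_map_mx;
  apply: (rmorph_unit (intr : {rmorphism int -> rat})).
  by rewrite -unitmxE.
rewrite LE; apply/seteqP; split=> v [z _ <-].
  by exists (invmx P *m z) => //; rewrite -mulmxA -map_mxM mulKVmx.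
by exists (P *m z) => //; rewrite map_mxM mulmxA.
Qed.

Lemma latticeC_basisP (B : 'M[rat]_n) (y : 'cV[R[i]]_n) : lattice_basis B ->
  reflect (exists z : 'cV[int]_n, y = map_mx intr z)
          (map_mx ratC B *m y \in @latticeC R n L).
Proof.
have ratzC (z : 'cV[int]_n) : map_mx ratC (map_mx intr z) = map_mx intr z.
  by rewrite -map_mx_comp; apply: eq_map_mx => k /=; rewrite ratr_int.
move=> [uB LE]; apply: (iffP idP) => [/asboolP[v]|[z ->]].
  rewrite LE => -[z _ <-]; rewrite map_mxM ratzC =>
    /(congr1 (mulmx (invmx (map_mx ratC B)))).
  by rewrite !mulKmx ?map_unitmx // => ->; exists z.
apply/asboolP; exists (B *m map_mx intr z); last by rewrite map_mxM ratzC.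
by rewrite LE; exists z.
Qed.

Lemma stable_basis_mx (B A : 'M[rat]_n) : lattice_basis B -> mx_stable L A ->
  exists N : 'M[int]_n, A *m B = B *m map_mx intr N.
Proof.
move=> [uB LE] LA.
have /fin_all_exists[f fE] (j : 'I_n) :
    exists z : 'cV[int]_n, A *m col j B = B *m map_mx intr z.
  have : lattice_set L (col j B).
    rewrite LE; exists (delta_mx j 0) => //.
    by rewrite map_delta_mx -colE.
  by move=> /LA; rewrite LE => -[z _ <-]; exists z.
exists (\matrix_(i, j) f j i 0); apply/matrixP => i j.
have := congr1 (fun v : 'cV_n => v i 0) (fE j); rewrite colE mulmxA -colE !mxE => ->.
by apply: eq_bigr => k _; rewrite !mxE.
Qed.

(* Changing bases by the two unimodular factors of the Smith normal form
   makes A - 1 diagonal. *)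
Lemma smith_bases (A : 'M[rat]_n) : mx_stable L A ->
  exists (B1 B2 : 'M[rat]_n) (d : 'I_n -> int),
    [/\ lattice_basis B1, lattice_basis B2,
        (A - 1%:M) *m B1 = B2 *m diag_mx (\row_i (d i)%:~R) &
        `|\det (A - 1%:M)| = (\prod_i `|d i|%N)%:R].
Proof.
move=> LA; have [B uB LE] := latticeP L; have bB : lattice_basis B by split.
have [N NE] := stable_basis_mx bB LA.
have [P uP [Q uQ [d _ ME]]] := int_Smith_normal_form (N - 1%:M).
pose D : 'M[int]_n := diag_mx (\row_i d`_i).
have {}ME : N - 1%:M = P *m D *m Q.
  rewrite ME; congr (_ *m _ *m _); apply/matrixP => i j; rewrite !mxE -val_eqE.
  by [].
have AB : (A - 1%:M) *m B = B *m map_mx intr (P *m D *m Q).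
  by rewrite -ME mulmxBl mul1mx NE map_mxB map_mx1 mulmxBr mulmx1.
exists (B *m map_mx intr (invmx Q)), (B *m map_mx intr P), (fun i => d`_i).
split.
- by apply: lattice_basis_mulr; rewrite ?unitmx_inv.
- exact: lattice_basis_mulr.
- rewrite mulmxA AB -mulmxA -map_mxM mulmxK // map_mxM mulmxA; congr (_ *m _).
  apply/matrixP => i j; rewrite !mxE; case: (i == j); rewrite ?mulr1n ?mulr0n //.
(* The two matrices are conjugate by [B]; the unimodular factors [P] and [Q] then contribute only
   signs. *)
have <- : \det (map_mx intr (P *m D *m Q)) = \det (A - 1%:M).
  apply: (mulfI (_ : \det B != 0)); first by rewrite -unitfE -unitmxE.
  by rewrite -det_mulmx -AB det_mulmx mulrC.
have n1 (U : 'M[int]_n) : U \in unitmx -> `|(\det U)%:~R| = 1 :> rat.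
  by rewrite unitmxE => /orP[]/eqP->; rewrite ?rmorphN1 ?normrN1 ?normr1.
rewrite det_map_mx !det_mulmx !rmorphM /= !normrM
  (n1 _ uP) (n1 _ uQ) mulr1 mul1r det_diag.
rewrite rmorph_prod normr_prod natr_prod; apply: eq_bigr => i _.
by rewrite mxE /= -intr_norm -abszE.
Qed.

(** By [smith_bases], the class of [B1 y] is fixed iff every [d_i y_i] is an integer. Modulo the
    lattice, [y_i] is then a class of [(1/d_i)Z] modulo [Z], with [|d_i|] choices. *)
Lemma card_torus_fixed (A : 'M[rat]_n) :
    mx_stable L A -> \det (A - 1%:M) != 0 ->
  exists2 X : {fset torus R L}, X =i [pred x | torus_mul A x == x] &
    (#|` X|)%:R = `|\det (A - 1%:M)|.
Proof.
move=> LA; rewrite -normr_eq0 => detn0.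
have [B1 [B2 [d [bB1 bB2 AB detE]]]] := smith_bases LA.
rewrite detE in detn0 *.
have d0 i : d i != 0.
  move: detn0; rewrite natr_prod => /prodf_neq0/(_ i isT).
  by rewrite pnatr_eq0 absz_eq0.
have dC0 i : (d i)%:~R != 0 :> R[i] by rewrite intr_eq0.
(* The [d i] may be negative: residues are indexed by the absolute value, while [coord] divides by
   [d i] itself. *)
pose T := fprod (fun i => 'I_(`|d i|%N) : finType).
pose coord (t : T) : 'cV[R[i]]_n := \col_i ((t i)%:R / (d i)%:~R).
pose f (t : T) : torus R L := (\pi_(torus R L) (map_mx ratC B1 *m coord t))%qT.
have piE (x y : 'cV[R[i]]_n) :
    ((\pi_(torus R L) x)%qT == (\pi_(torus R L) y)%qT) = (x - y \in @latticeC R n L).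
  by rewrite Quotient.idealrBE.
have fixE (y : 'cV[R[i]]_n) :
    reflect (exists z : 'cV[int]_n, forall i, (d i)%:~R * y i 0 = (z i 0)%:~R)
      (torus_mul A (\pi_(torus R L) (map_mx ratC B1 *m y))%qT
       == (\pi_(torus R L) (map_mx ratC B1 *m y))%qT).
  rewrite torus_mulE // piE.
  have -> : map_mx ratC A *m (map_mx ratC B1 *m y) - map_mx ratC B1 *m y
          = map_mx ratC B2 *m \col_i ((d i)%:~R * y i 0).
    transitivity (map_mx ratC ((A - 1%:M) *m B1) *m y).
      by rewrite map_mxM map_mxB map_mx1 mulmxBl mul1mx mulmxBl mulmxA.
    rewrite AB map_mxM -mulmxA; congr (_ *m _); apply/matrixP => i j.
    by rewrite map_diag_mx mul_diag_mx !mxE /= ratr_int (ord1 j).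
  apply: (iffP (latticeC_basisP _ bB2)) => -[z zE]; exists z.
    by move=> i; have := congr1 (fun v : 'cV_n => v i 0) zE; rewrite !mxE.
  by apply/matrixP => i j; rewrite !mxE (ord1 j) zE.
have f_inj : injective f.
  move=> t t' /eqP; rewrite piE -mulmxBr => /(latticeC_basisP _ bB1)[z zE].
  rewrite -[t]fprodK -[t']fprodK; congr fprod_of_fun.
  apply: functional_extensionality_dep => i; apply: val_inj.
  have := congr1 (fun v : 'cV_n => v i 0) zE; rewrite !mxE -mulrBl.
  move=> /(canRL (divfK (dC0 i))); rewrite !pmulrn -rmorphB -rmorphM /= => /intr_inj tE.
  have : (t i = t' i %[mod d i])%Z.
    by apply/eqP; rewrite eqz_mod_dvd -/(_ - _) tE dvdz_mull.
  rewrite -[X in (X = _)%Z]modz_abs -[X in (_ = X)%Z]modz_abs.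
  by rewrite !modz_nat !modn_small // => -[].
exists [fset f t | t in T]%fset; last first.
  rewrite card_in_imfset /= => [|t t' _ _]; last exact: f_inj.
  rewrite -cardE card_fprod; congr _%:R; apply: eq_bigr => i _.
  exact: card_ord.
move=> x; rewrite inE; apply/imfsetP/idP => [[t _ ->]|].
  apply/fixE; exists (\col_i (t i)%:Z) => i.
  by rewrite !mxE mulrC divfK.
elim/generic_quotient.quotW: x => v.
have uB1 : map_mx ratC B1 \in unitmx by rewrite map_unitmx; case: bB1.
rewrite -[v](mulKVmx uB1); move: (invmx _ *m v) => y /fixE[z zE].
(* Euclidean division of [z_i = d_i y_i] by [d_i]: the remainders give the preimage in [T], the
   quotients the lattice vector separating it from [y]. *)
have zd i : (`|modz (z i 0)%R (d i)| < `|d i|)%N.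
  by rewrite -ltz_nat !abszE ger0_norm ?modz_ge0 // ltz_mod.
exists (fprod_of_fun (fun i => Ordinal (zd i)) : T) => //.
apply/eqP; rewrite piE -mulmxBr; apply/(latticeC_basisP _ bB1).
exists (\col_i divz (z i 0) (d i)); apply/matrixP => i j; rewrite (ord1 j).
rewrite !mxE fprodE /=.
apply: (mulfI (dC0 i)); rewrite mulrBr zE mulrCA mulfV // mulr1.
rewrite {1}(divz_eq (z i 0) (d i)) natr_absz ger0_norm ?modz_ge0 //.
by rewrite rmorphD addrK rmorphM mulrC.
Qed.
End TorusFixedPoints.

(** * Counting non-free points through their stabilizers *)

Section FpfTorus.
Variables (R : realType) (gT : finGroupType) (G : {group gT}) (n : nat).
Variables (rG : mx_representation rat G n) (L : lattice n).
Hypothesis fpf : fpf_repr rG.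
Hypothesis invL : lattice_invariant rG L.

Lemma torus_stab_group_set (x : torus R L) : group_set (torus_stab rG x).
Proof.
elim/generic_quotient.quotW: x => v; apply/group_setP; split.
  rewrite inE group1 /= torus_mulE; last exact: invL.
  by rewrite repr_mx1 map_mx1 mul1mx.
move=> g h; rewrite !inE => /andP[gG /eqP gv] /andP[hG /eqP hv].
rewrite groupM //= torus_mulE; last by apply: invL; rewrite groupM.
rewrite repr_mxM // map_mxM -mulmxA -torus_mulE; last exact: invL.
by rewrite -torus_mulE ?hv ?gv //; exact: invL.
Qed.

Canonical torus_stab_group x := Group (torus_stab_group_set x).

Lemma torus_stab_sub (x : torus R L) : torus_stab rG x \subset G.
Proof. by apply/fintype.subsetP => g; rewrite inE => /andP[]. Qed.

Lemma card_cyclic_fixed (C : {group gT}) : C \subset G -> cyclic C -> C :!=: 1%g ->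
  exists2 X : {fset torus R L}, X =i [pred x | C \subset torus_stab rG x] &
    (#|` X|)%:R = (('Phi_#|C|).[1])%:~R `^ (n%:R / (totient #|C|)%:R) :> R.
Proof.
move=> CG /cyclicP[g CE]; have gG : g \in G by rewrite -cycle_subG -CE.
rewrite CE -orderE cycle_eq1 => g1.
have [_ /(_ g gG g1) d0] := fpf.
have [X XE cX] := card_torus_fixed R (invL gG) d0; exists X.
  by move=> x; rewrite XE !inE cycle_subG inE gG.
have [k nE detE] := fpf_norm_det fpf gG g1.
(* The determinant is rational and the target real, so the equality passes through the integers. *)
have {cX} : (#|` X|)%:Z = ('Phi_#[g]%g).[1] ^+ k.
  by apply: (@intr_inj rat); rewrite rmorphXn /= -detE -cX.
move=> /(congr1 (intr : int -> R)); rewrite rmorphXn /= => cX.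
have t0 : (totient #[g]%g)%:R != 0 :> R.
  by rewrite pnatr_eq0 -lt0n totient_gt0 order_gt0.
(* The real exponent is the natural number [k], so the real power is an ordinary one. *)
rewrite (congr1 (fun m => m%:R) nE) natrM mulfK // powR_mulrn; first exact: cX.
rewrite ler0z Order.POrderTheory.ltW //.
by rewrite Cyclotomic_at1_gt0 ?order_gt1.
Qed.

Lemma card_nonfree :
  finite_set (nonfree R rG L) /\
  (#|` fset_set (nonfree R rG L)|)%:R =
    - \sum_(C : {group gT} | ((C \subset G) && cyclic C) && (C :!=: 1%g))
        (moebius #|C|)%:~R *
        (('Phi_#|C|).[1])%:~R `^ (n%:R / (totient #|C|)%:R) :> R.
Proof.
pose P (C : {group gT}) := ((C \subset G) && cyclic C) && (C :!=: 1%g).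
have /boolp.choice[X XP] (C : {group gT}) : exists X : {fset torus R L}, P C ->
    X =i [pred x | C \subset torus_stab rG x] /\
    (#|` X|)%:R = (('Phi_#|C|).[1])%:~R `^ (n%:R / (totient #|C|)%:R) :> R.
  case PC: (P C); last by exists fset0.
  have [/andP[CG cC] C1] := andP PC.
  by have [X XE cX] := card_cyclic_fixed CG cC C1; exists X.
(* This is [fpf_sum_moebius] for the stabilizer, with the term 1 of the trivial subgroup moved
   across. *)
have stabE (x : torus R L) :
    - \sum_(C : {group gT} | P C && (C \subset torus_stab rG x)) moebius #|C|
    = (torus_stab rG x != 1%g)%:R.
  have := fpf_sum_moebius fpf (torus_stab_sub x).
  rewrite (bigD1 1%G) ?sub1G ?cyclic1 //= cards1.
  rewrite (eq_bigl (fun C : {group gT} => P C && (C \subset torus_stab rG x))).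
    rewrite -trivg_card1; case: (_ == 1%g) => /=; last by move=> /eqP; rewrite addr_eq0 => /eqP <-.
    by move=> /(canRL (addKr _)) ->; rewrite addNr oppr0.
  move=> C; rewrite /P -[C != 1%G]/(val C != 1%g).
  case: (boolP (C \subset torus_stab rG x)) => //= Cx; last by rewrite andbF.
  by rewrite (fintype.subset_trans Cx (torus_stab_sub x)) andbT.
have fin : finite_set (nonfree R rG L).
  (* At a non-free point the sum in [stabE] is nonzero, hence nonempty: the point lies in one of
     finitely many finite sets [X C]. *)
  apply: (@finite_subfset _ (\bigcup_(C | P C) X C)%fset) => x /eqP nx.
  have : \sum_(C : {group gT} | P C && (C \subset torus_stab rG x)) moebius #|C| != 0.
    by rewrite -oppr_eq0 stabE nx.
  case: (pickP (fun C : {group gT} => P C && (C \subset torus_stab rG x))).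
    move=> C /andP[PC Cx] _ /=; apply/bigfcupP; exists C; rewrite ?mem_index_enum //.
    by have [-> _] := XP C PC.
  by move=> none /negP[]; rewrite big_pred0.
split=> //; set S := fset_set _.
have memS x : (x \in S) = (torus_stab rG x != 1%g).
  by rewrite in_fset_set //; apply/asboolP/idP => /eqP.
have -> : (#|` S|)%:R = (\sum_(x <- S) (1 : int))%:~R :> R.
  by rewrite big_const_seq count_predT iter_addr addr0 -mulr_natr mul1r rmorph_nat.
rewrite (eq_big_seq (fun x => - \sum_(C : {group gT} | P C && (C \subset torus_stab rG x))
    moebius #|C|)); last by move=> x; rewrite memS stabE => ->.
rewrite sumrN rmorphN; congr (- _).
rewrite (exchange_big_dep P) /=; last by move=> x C _ /andP[].
rewrite rmorph_sum; apply: eq_bigr => C PC; have [XE <-] := XP C PC.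
rewrite -big_filter (@perm_big _ _ _ _ _ (X C)).
  by rewrite big_const_seq count_predT iter_addr addr0 rmorphMn mulr_natr.
apply: uniq_perm; rewrite ?filter_uniq ?fset_uniq // => x.
rewrite mem_filter -[X in _ && X]/(x \in S) -[RHS]/(x \in X C).
rewrite XE PC memS inE /=; apply: andb_idr => Cx.
(* A point fixed by a nontrivial [C] is non-free, so restricting to [S] loses nothing of [X C]. *)
have [_ /negP C1] := andP PC; apply/negP => /eqP x1; apply: C1.
by rewrite -subG1 -x1.
Qed.

End FpfTorus.

Theorem theorem3p5 (R : realType) (gT : finGroupType) (G : {group gT})
  (n : nat) (rG : mx_representation rat G n) (L : lattice n) :
  fpf_repr rG -> lattice_invariant rG L ->
  finite_set (nonfree R rG L) /\
  (#|` fset_set (nonfree R rG L)|)%:R =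
    - \sum_(d <- divisors #|G|)
        (moebius d)%:~R * (ncyclic G d)%:R *
        (('Phi_d).[1])%:~R `^ (n%:R / (totient d)%:R) :> R.
Proof.
move=> fpf invL; have [fin ->] := card_nonfree R fpf invL; split=> //.
congr (- _); under [RHS]eq_bigr do rewrite mulrAC mulr_natr.
rewrite -(sum_cyclic_subgroups _ (fun d => (moebius d)%:~R *
  (('Phi_d).[1])%:~R `^ (n%:R / (totient d)%:R))) [RHS](bigD1 1%G) /=; last first.
  by rewrite sub1G cyclic1.
(* The trivial subgroup contributes [Phi_1(1) = 0] to the power [n], which is 0 because [n] is
   positive. *)
have [n0 _] := fpf.
rewrite cards1 Cyclotomic1E hornerD hornerN hornerX hornerC subrr powR0 ?mulr0 ?add0r //.
by rewrite divr1 pnatr_eq0 -lt0n.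
Qed.
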